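(* Let a uniformly random sequence of edges of arbitrary length $m\le\binom n2$ (the first $m$ edges of a uniformly random permutation of all possible edges on $n$ vertices) be inserted one by one into an initially empty undirected graph on $n$ vertices. Then the expected total time taken by the algorithm ADFS1 to maintain a DFS tree incrementally over this sequence is $O(n^2\sqrt{\log n})$.
   Context: Incremental DFS problem: edges are inserted online into an undirected graph on $n$ vertices, and after each insertion a DFS tree of the current graph must be available. The graph is augmented with a pseudo root $s$ adjacent to all vertices, and the tree is rooted at $s$. A rooted spanning tree of an undirected graph is a DFS tree iff there are no cross edges, i.e. every non-tree edge joins a vertex to one of its ancestors (such an edge is a back edge). $T(v)$ is the subtree of the maintained tree $T$ rooted at $v$, $path(x,y)$ the tree path from $x$ to $y$, $LCA(x,y)$ the lowest common ancestor. Algorithm ADFS1: it maintains $T$ together with a data structure answering LCA and level-ancestor queries in $O(1)$ time, which is updated in $O(1)$ amortized time per vertex whose ancestors change. On insertion of an edge $(x,y)$ it computes $w=LCA(x,y)$. If $w\in\{x,y\}$, the edge is a back edge; it is added to the graph and nothing else is done. Otherwise let $u,v$ be the children of $w$ with $x\in T(u)$, $y\in T(v)$, named so that $x$ is not higher in $T$ (closer to the root) than $y$. The algorithm reroots $T(v)$ at $y$ by reversing $path(y,v)$ and hangs it from $x$ through the edge $(x,y)$. This reversal converts some back edges with both endpoints in $T(v)$ into cross edges; these are collected and then inserted back into the graph iteratively by the same procedure, in arbitrary order. The collected edges waiting to be processed, together with those collected during their re-insertion, are processed until none remains. The running time is the number of edges processed plus the time for updating the LCA/level-ancestor data structure, which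 is $O(1)$ amortized for each vertex whose ancestors in $T$ change. *)

(* Defs.v *)
From HB Require Import structures.
From mathcomp Require Import all_boot all_order all_fingroup all_algebra.

Set Implicit Arguments.
Unset Strict Implicit.
Unset Printing Implicit Defensive.

Import Order.TTheory GRing.Theory Num.Theory.

Notation edge n := {e : {set 'I_n} | #|e| == 2%N}.

(* The vertices of the augmented graph form [option 'I_n], where [None] is the
   pseudo root s.  The edges joining s to the other vertices stay implicit:
   they are always present and never become cross edges.  A tree rooted at s
   is given by its parent map. *)
Notation vertex n := (option 'I_n).
Notation dfs_tree n := {ffun 'I_n -> option 'I_n}.

Section Tree.
Variables (n : nat) (T : dfs_tree n).
Implicit Types (z v w : vertex n) (c x y : 'I_n) (e : edge n).

(* The root s is a fixed point of [up], so that iterating [up] from a vertex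
   visits exactly its ancestors. *)
Definition up (z : vertex n) : vertex n := obind T z.

(* A vertex is an ancestor of itself. *)
Definition ancestors z : {set vertex n} := [set a | fconnect up z a].

Definition subtree v : {set vertex n} := [set z | v \in ancestors z].

Definition depth z : nat := #|ancestors z :\ z|.

Definition lca z z' : vertex n :=
  [arg max_(a > None | a \in ancestors z :&: ancestors z') depth a].

(* The child c of w such that z lies in T(c); it exists whenever w is a proper
   ancestor of z, the only case in which it is used. *)
Definition child_toward w z : vertex n :=
  [pick c : 'I_n | (T c == w) && (z \in subtree (Some c))].

(* path(z, v), for an ancestor v of z *)
Definition tree_path z v : {set vertex n} := ancestors z :&: subtree v.

(* Reverse path(y, v), so that T(v) becomes rooted at y, and hang it from x. *)
Definition reroot v y x : dfs_tree n :=
  [ffun z : 'I_n =>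
     if z == y then Some x
     else if Some z \in tree_path (Some y) v
          then child_toward (Some z) (Some y)
          else T z].

Definition cross_edge e : bool :=
  ~~ [exists a in val e, [forall b in val e, Some a \in ancestors (Some b)]].

End Tree.

Definition changed n (T T' : dfs_tree n) : {set 'I_n} :=
  [set z | ancestors T (Some z) != ancestors T' (Some z)].

(* The choices that ADFS1 leaves open: which waiting edge is processed next, and
   which endpoint plays the role of x when both have the same depth.  They may
   depend on the edges inserted so far (including the one being inserted), the
   current tree and the set of waiting edges, but not on future insertions.
   The graph, and in fact the whole execution so far, is determined by these
   arguments. *)
Record policy n := Policy {
  next_edge : seq (edge n) -> dfs_tree n -> {set edge n} -> edge n;
  next_edge_in : forall h T (Q : {set edge n}), Q != set0 -> next_edge h T Q \in Q;
  lower_end : seq (edge n) -> dfs_tree n -> {set edge n} -> edge n -> 'I_n;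
  lower_end_in : forall h T Q (e : edge n), lower_end h T Q e \in val e;
  lower_end_depth : forall h T Q (e : edge n) y, y \in val e ->
    (depth T (Some y) <= depth T (Some (lower_end h T Q e)))%N }.

Definition other_end n (e : edge n) (x : 'I_n) : 'I_n :=
  odflt x [pick y in val e | y != x].

Record state n := State {
  inserted : seq (edge n);
  upcoming : seq (edge n);
  tree : dfs_tree n;
  graph : {set edge n};    (* tree edges and back edges, without those to s *)
  waiting : {set edge n};
  nprocessed : nat;
  nchanged : nat }.        (* counts a vertex once for each change *)

Section ADFS1.
Variables (n : nat) (p : policy n).

Definition process (S : state n) : state n :=
  let h := inserted S in
  let T := tree S in
  let G := graph S in
  let Q := waiting S in
  let e := next_edge p h T Q in
  let x := lower_end p h T Q e in
  let y := other_end e x in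
  let w := lca T (Some x) (Some y) in
  if w \in [set Some x; Some y] then
    State h (upcoming S) T (e |: G) (Q :\ e) (nprocessed S).+1 (nchanged S)
  else
    let v := child_toward T w (Some y) in
    let T' := reroot T v y x in
    let collected := [set f in G | cross_edge T' f] in
    State h (upcoming S) T' (e |: (G :\: collected)) ((Q :\ e) :|: collected)
      (nprocessed S).+1 (nchanged S + #|changed T T'|)%N.

(* A new edge is inserted only once no edge is waiting. *)
Definition step (S : state n) : state n :=
  if waiting S != set0 then process S
  else if upcoming S is e :: es then
    State (rcons (inserted S) e) es (tree S) (graph S) [set e]
      (nprocessed S) (nchanged S)
  else S.

Definition initial (es : seq (edge n)) : state n :=
  State [::] es [ffun=> None] set0 set0 0 0.

Definition run (es : seq (edge n)) (k : nat) : state n :=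
  iter k step (initial es).

End ADFS1.

Definition first_edges n (m : nat) (s : {perm edge n}) : seq (edge n) :=
  take m [seq s e | e <- enum {: edge n}].

(* Imported only here: classical_sets redefines the notations of finset. *)
From mathcomp Require Import boolp classical_sets reals ereal exp.

(* Totals over the complete execution on the insertion sequence [es]; they would
   be infinite if it did not terminate. *)
Definition edges_processed n (p : policy n) (R : realType) (es : seq (edge n)) : \bar R :=
  ereal_sup (range (fun k => (nprocessed (run p es k))%:R%:E))%classic.

Definition vertices_changed n (p : policy n) (R : realType) (es : seq (edge n)) : \bar R :=
  ereal_sup (range (fun k => (nchanged (run p es k))%:R%:E))%classic.

Definition uniform_mean (R : realType) (W : finType) (X : W -> \bar R) : \bar R :=
  ((#|W|%:R^-1)%:E * \sum_(i : W) X i)%E.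

(* Main.v *)
(* Every rerooting strictly increases the depth of each vertex of the moved
   subtree T(v), so the total depth, at most n(n+1)/2, bounds the number of
   ancestor changes.  For the edges processed, fix t: a collected edge has its
   upper endpoint a on the reversed path, and a gains more than twice its
   distance to y.  Edges whose upper endpoint gains at least t levels are charged
   to it, at most (maximal degree)/t per level gained; the others have their upper
   endpoint among the t lowest path vertices and are charged to the lower
   endpoint, at most t per level gained.  While there are O(n t^2) edges, the
   degrees are O(t^2) with high probability once t^2 >= log n, so collecting costs
   O(t) edges per unit of total depth gained.  With t^2 close to log n this pays
   O(n^2 sqrt(log n)) for the first O(n log n) insertions.

   Afterwards t doubles each time the number of edges quadruples, but the depth
   still to be gained shrinks by 4: with N = n t^2 edges, with high probability any
   two disjoint sets of k = O(n^2 log n / N) vertices are joined by an edge, and then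
   in every DFS tree all but 5k vertices lie on one path from the root, so that
   only O(k n) pairs of vertices are incomparable.  Since twice the total depth
   plus the number of incomparable ordered pairs is n^2 + n, the costs of the
   phases form a geometric series.  Both random properties concern the graph alone,
   so the argument covers whatever tree an adaptive policy produces.  The
   exceptional orders have probability at most 2/n and cost O(n^3) each. *)

Require Import Defs.
From HB Require Import structures.
From mathcomp Require Import all_boot all_order all_fingroup all_algebra.
From mathcomp Require Import zify ring lra.

Set Implicit Arguments.
Unset Strict Implicit.
Unset Printing Implicit Defensive.

Local Open Scope nat_scope.

(** * Ancestors in a rooted tree *)

Section TreeTheory.
Variables (n : nat) (T : dfs_tree n).
Implicit Types (a b z w : vertex n) (c : 'I_n).

(** Parent maps may contain cycles; reaching the root from every vertex excludes them. *)
Definition rooted := forall z, None \in ancestors T z.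

Lemma anc_refl z : z \in ancestors T z.
Proof. by rewrite inE connect0. Qed.

Lemma anc_trans b a z :
  a \in ancestors T b -> b \in ancestors T z -> a \in ancestors T z.
Proof. by rewrite !inE => ab bz; exact: connect_trans ab. Qed.

Lemma anc_Some a c :
  (a \in ancestors T (Some c)) = (a == Some c) || (a \in ancestors T (T c)).
Proof. by rewrite !inE fconnect_eqVf eq_sym. Qed.

Lemma anc_up a c : a \in ancestors T (T c) -> a \in ancestors T (Some c).
Proof. by rewrite anc_Some orbC => ->. Qed.

Lemma iter_up_None k : iter k (up T) None = None.
Proof. by elim: k => //= k ->. Qed.

Lemma anc_None a : (a \in ancestors T None) = (a == None).
Proof.
rewrite inE; apply/idP/eqP => [/iter_findex <-|->]; last exact: connect0.
exact: iter_up_None.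
Qed.

Lemma in_subtree z w : (z \in subtree T w) = (w \in ancestors T z).
Proof. by rewrite inE. Qed.

Hypothesis rT : rooted.

Lemma tree_ind (P : vertex n -> Prop) :
  P None -> (forall c, P (T c) -> P (Some c)) -> forall z, P z.
Proof.
move=> P0 PS z; have := rT z; rewrite inE => /iter_findex.
move: (findex _ _ _) => k; elim: k z => [z /= ->//|k IHk [c|] // ].
by rewrite iterSr /= => /IHk/PS.
Qed.

Lemma anc_acyclic c : Some c \notin ancestors T (T c).
Proof.
apply/negP; rewrite inE => /iter_findex.
move: (findex _ _ _) => k Ek.
have per j : iter (j * k.+1) (up T) (Some c) = Some c.
  by elim: j => // j IHj; rewrite mulSn addnC iterD iterSr /= Ek.
have := rT (Some c); rewrite inE => /iter_findex.
(* The root absorbs: [j] steps already reach it, so [j * k.+1] steps cannot return to [Some c]. *)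
move: (findex _ _ _) => j Ej; have := per j.
by rewrite mulnS addnC iterD Ej iter_up_None.
Qed.

Lemma anc_antisym a b : a \in ancestors T b -> b \in ancestors T a -> a = b.
Proof.
case: b => [c|]; last by rewrite anc_None => /eqP.
rewrite anc_Some => /orP[/eqP//|ac ca].
by have := anc_acyclic c; rewrite (anc_trans ca ac).
Qed.

Lemma card_ancestors z : #|ancestors T z| = (depth T z).+1.
Proof. by rewrite (cardsD1 z) anc_refl. Qed.

Lemma depth_Some c : depth T (Some c) = (depth T (T c)).+1.
Proof.
rewrite -card_ancestors; apply: eq_card => a.
rewrite in_setD1 anc_Some; case: eqP => [->|] //=.
by rewrite (negPf (anc_acyclic c)).
Qed.

Lemma anc_depth a z : a \in ancestors T z -> depth T a <= depth T z.
Proof.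
move=> az; rewrite -ltnS -!card_ancestors; apply/subset_leq_card/subsetP => b.
by move/anc_trans; apply.
Qed.

Lemma anc_depth_lt a z :
  a \in ancestors T z -> a != z -> depth T a < depth T z.
Proof.
case: z => [c|]; last by rewrite anc_None => ->.
rewrite anc_Some depth_Some ltnS => /orP[->//|/anc_depth //].
Qed.

Lemma anc_depth_eq a z :
  a \in ancestors T z -> depth T z <= depth T a -> a = z.
Proof.
move=> az; case: (eqVneq a z) => // ne; by have := anc_depth_lt az ne; lia.
Qed.

Lemma anc_chain a b z : a \in ancestors T z -> b \in ancestors T z ->
  (a \in ancestors T b) || (b \in ancestors T a).
Proof.
elim/tree_ind: z => [|c IH]; first by rewrite !anc_None => /eqP-> /eqP->; rewrite anc_refl.
rewrite 2!anc_Some => /orP[/eqP->|ac] /orP[/eqP->|bc]; rewrite ?anc_refl //.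
- by rewrite (anc_up bc) orbT.
- by rewrite (anc_up ac).
- exact: IH.
Qed.

Lemma anc_depth_inj z a b : a \in ancestors T z -> b \in ancestors T z ->
  depth T a = depth T b -> a = b.
Proof.
move=> az bz Ed; case/orP: (anc_chain az bz) => /anc_depth_eq; rewrite Ed => H.
  exact: H.
exact/esym/H.
Qed.

Lemma anc_child a z : a \in ancestors T z -> a != z ->
  exists2 c, T c = a & Some c \in ancestors T z.
Proof.
elim/tree_ind: z => [|c IH]; first by rewrite anc_None => ->.
rewrite anc_Some => /orP[->//|aTc] _.
have [->|/(IH aTc)[d Td dTc]] := eqVneq a (T c); first by exists c; rewrite ?anc_refl.
by exists d => //; exact: anc_up.
Qed.

Lemma child_towardP a z : a \in ancestors T z -> a != z ->
  exists c, [/\ child_toward T a z = Some c, T c = a & Some c \in ancestors T z].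
Proof.
move=> az ne; rewrite /child_toward; case: pickP => [c /andP[/eqP Tc]|no].
  by rewrite in_subtree; exists c.
have [c Tc cz] := anc_child az ne.
by have := no c; rewrite Tc eqxx in_subtree cz.
Qed.

Lemma lcaP z z' : [/\ lca T z z' \in ancestors T z, lca T z z' \in ancestors T z' &
  forall a, a \in ancestors T z -> a \in ancestors T z' ->
    depth T a <= depth T (lca T z z')].
Proof.
rewrite /lca; case: arg_maxnP => [|a]; first by rewrite inE !rT.
rewrite inE => /andP[az az'] amax; split=> // b bz bz'.
by apply: amax; rewrite inE bz.
Qed.

(* The root supplies the missing unit: [z] has as many proper ancestors as it
   has ancestors other than the root. *)
Lemma depth_sum : \sum_(c : 'I_n) depth T (Some c) =
  \sum_(c : 'I_n) \sum_(d : 'I_n) (Some d \in ancestors T (Some c)).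
Proof.
apply: eq_bigr => c _; apply/eqP; rewrite -eqSS -card_ancestors.
rewrite (cardsD1 None) rT add1n eqSS; apply/eqP.
transitivity #|[set Some d | d in [set d | Some d \in ancestors T (Some c)]]|.
  apply: eq_card => -[d|]; rewrite in_setD1 /=.
    by rewrite mem_imset ?inE //; exact: Some_inj.
  by symmetry; apply/imsetP => -[].
rewrite card_imset; last exact: Some_inj.
by rewrite -sum1dep_card big_mkcond.
Qed.

Definition tree_comparable (c d : 'I_n) : bool :=
  (Some c \in ancestors T (Some d)) || (Some d \in ancestors T (Some c)).

Definition incomparable_pairs : {set 'I_n * 'I_n} :=
  [set q | ~~ tree_comparable q.1 q.2].

(** For an ordered pair, the two ancestor indicators and the incomparability indicator add up to 1,
    and to 2 on the diagonal, by antisymmetry. *)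
Lemma double_depth_sum :
  2 * (\sum_(c : 'I_n) depth T (Some c)) + #|incomparable_pairs| = n ^ 2 + n.
Proof.
have -> : #|incomparable_pairs| = \sum_(c : 'I_n) \sum_(d : 'I_n) ~~ tree_comparable c d.
  rewrite pair_bigA -sum1dep_card big_mkcond /=.
  by apply: eq_bigr => -[c d] _ /=; case: tree_comparable.
have -> : n ^ 2 + n = \sum_(c : 'I_n) \sum_(d : 'I_n) (1 + (d == c)).
  rewrite (eq_bigr (fun=> n.+1)); first by rewrite sum_nat_const card_ord; lia.
  move=> c _; rewrite big_split /= sum1_card card_ord -addn1; congr (_ + _).
  by rewrite (bigD1 c) //= eqxx big1 // => d /negPf->.
rewrite depth_sum mul2n -addnn {2}exchange_big -!big_split; apply: eq_bigr => c _.
rewrite -!big_split; apply: eq_bigr => d _ /=; rewrite /tree_comparable.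
have [->|dc] := eqVneq d c; first by rewrite anc_refl.
case: (boolP (Some d \in _)) => dc1; case: (boolP (Some c \in _)) => cd1 //=.
by case/eqP: dc; case: (anc_antisym dc1 cd1).
Qed.

End TreeTheory.

(** * Rerooting a subtree *)

(* [simpl] identifies the two forms ['I_n] and [Finite.sort _] of the index type,
   which [lia] would treat as distinct atoms. *)
Ltac nlia := simpl in *; lia.

Section Reroot.
Variables (n : nat) (T : dfs_tree n) (v x y : 'I_n).
Hypothesis rT : rooted T.
Hypothesis vy : Some v \in ancestors T (Some y).
Hypothesis vNx : Some v \notin ancestors T (Some x).
Hypothesis Tvx : T v \in ancestors T (Some x).
Hypothesis yx : depth T (Some y) <= depth T (Some x).

Let T' := reroot T (Some v) y x.
Let P := tree_path T (Some y) (Some v).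

Lemma in_path z :
  (z \in P) = (z \in ancestors T (Some y)) && (Some v \in ancestors T z).
Proof. by rewrite in_setI in_subtree. Qed.

Lemma path_end : Some y \in P.
Proof. by rewrite in_path anc_refl vy. Qed.

Lemma reroot_end : T' y = Some x.
Proof. by rewrite ffunE eqxx. Qed.

Lemma reroot_off a : Some a \notin P -> T' a = T a.
Proof.
move=> aP; rewrite ffunE -/P (negPf aP); case: eqP => // ay.
by rewrite ay path_end in aP.
Qed.

Lemma reroot_on a : Some a \in P -> a != y ->
  exists b, [/\ T' a = Some b, T b = Some a & Some b \in P].
Proof.
move=> aP ay; have := aP; rewrite in_path => /andP[aay va].
have ay' : Some a != Some y by [].
have [b [Eb Tb bay]] := child_towardP rT aay ay'.
exists b; rewrite ffunE (negPf ay) -/P aP Eb in_path bay; split=> //.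
by apply: anc_up; rewrite Tb.
Qed.

Lemma anc_reroot_out z :
  Some v \notin ancestors T z -> ancestors T' z = ancestors T z.
Proof.
elim/(tree_ind rT): z => [_|a IH va]; first by apply/setP => b; rewrite !anc_None.
have va' : Some v \notin ancestors T (T a) by apply: contra va => /anc_up.
apply/setP => b; rewrite !anc_Some reroot_off ?IH //.
by rewrite in_path (negPf va) andbF.
Qed.

Lemma depth_reroot_out z :
  Some v \notin ancestors T z -> depth T' z = depth T z.
Proof. by move=> vz; rewrite /depth anc_reroot_out. Qed.

Lemma path_ind (Q : 'I_n -> Prop) :
  Q y -> (forall a b, Some a \in P -> T' a = Some b -> T b = Some a -> Some b \in P ->
    Q b -> Q a) ->
  forall a, Some a \in P -> Q a.
Proof.
move=> Qy QS a; have [k] := ubnP (depth T (Some y) - depth T (Some a)).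
elim: k a => // k IH a le_k aP; have [->//|ay] := eqVneq a y.
have [b [T'a Tb bP]] := reroot_on aP ay.
apply: (QS a b) => //; apply: IH => //.
have Db := depth_Some rT b; rewrite Tb in Db.
have Dy : depth T (Some b) <= depth T (Some y).
  by apply: anc_depth => //; move: bP; rewrite in_path => /andP[].
nlia.
Qed.

Lemma subtree_ind (Q : 'I_n -> Prop) :
  (forall a, Some a \in P -> Q a) ->
  (forall a b, Some a \notin P -> T a = Some b -> Some v \in ancestors T (Some b) ->
    Q b -> Q a) ->
  forall a, Some v \in ancestors T (Some a) -> Q a.
Proof.
move=> QP QS a; suff H z : Some v \in ancestors T z -> if z is Some a then Q a else True.
  exact: (H (Some a)).
elim/(tree_ind rT): z => // {}a IH va.
have [/QP//|aP] := boolP (Some a \in P).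
have : Some a != Some v.
  by apply: contra aP => /eqP->; rewrite in_path vy anc_refl.
move: va IH; rewrite anc_Some eq_sym => /orP[->//|va IH _].
case E: (T a) va IH => [b|]; first by move=> vb /(_ vb); exact: QS.
by rewrite anc_None.
Qed.

Lemma anc_reroot_in a : Some v \in ancestors T (Some a) ->
  Some x \in ancestors T' (Some a).
Proof.
move: a; apply: subtree_ind => [a|a b aP Ta vb IH].
  move: a; apply: path_ind => [|a b aP T'a _ _ IH]; rewrite anc_Some.
    by rewrite reroot_end anc_refl orbT.
  by rewrite T'a IH orbT.
by rewrite anc_Some reroot_off // Ta IH orbT.
Qed.

Lemma reroot_rooted : rooted T'.
Proof.
move=> z; have [vz|vz] := boolP (Some v \in ancestors T z); last first.
  by rewrite anc_reroot_out.
case: z vz => [a va|]; last by rewrite anc_None.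
by apply: anc_trans (anc_reroot_in va); rewrite anc_reroot_out.
Qed.

(** Each step up the old path lowers the old depth by one and raises the new depth by one, so their
    sum keeps its value at [y]. *)
Lemma depth_reroot_on a : Some a \in P ->
  depth T' (Some a) + depth T (Some a) = depth T (Some x) + depth T (Some y) + 1.
Proof.
move: a; apply: path_ind => [|a b aP T'a Tb bP IH].
  by rewrite (depth_Some reroot_rooted) reroot_end depth_reroot_out //; nlia.
rewrite (depth_Some rT b) Tb in IH.
by rewrite (depth_Some reroot_rooted) T'a; nlia.
Qed.

Lemma path_depth a : Some a \in P -> depth T (Some a) <= depth T (Some y).
Proof. by rewrite in_path => /andP[/anc_depth]. Qed.

(** On the path this uses that [x] is at least as deep as [y]; off the path a vertex shifts with its
    unchanged parent. *)
Lemma depth_reroot_in a : Some v \in ancestors T (Some a) ->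
  depth T (Some a) < depth T' (Some a).
Proof.
move: a; apply: subtree_ind => [a aP|a b aP Ta vb IH].
  by have := depth_reroot_on aP; have := path_depth aP; nlia.
by rewrite (depth_Some rT) (depth_Some reroot_rooted) reroot_off // Ta ltnS.
Qed.

Lemma depth_reroot a : depth T (Some a) <= depth T' (Some a).
Proof.
have [/depth_reroot_in/ltnW//|va] := boolP (Some v \in ancestors T (Some a)).
by rewrite depth_reroot_out.
Qed.

Lemma changed_reroot :
  #|changed T T'| + \sum_a depth T (Some a) <= \sum_a depth T' (Some a).
Proof.
rewrite -sum1_card big_mkcond -big_split; apply: leq_sum => a _ /=.
rewrite inE; case: ifP => [ne|_]; last exact: depth_reroot.
apply: depth_reroot_in; apply: contraTT ne => va.
by rewrite negbK eq_sym; apply/eqP/anc_reroot_out.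
Qed.

Lemma anc_reroot_off a z : Some v \in ancestors T (Some a) -> Some a \notin P ->
  Some a \in ancestors T z -> Some a \in ancestors T' z.
Proof.
move=> va aP; elim/(tree_ind rT): z => [|b IH]; first by rewrite anc_None.
rewrite anc_Some => /orP[/eqP->|aTb]; first exact: anc_refl.
rewrite anc_Some reroot_off ?IH ?orbT //.
apply: contra aP; rewrite !in_path va andbT => /andP[yb _].
by apply: anc_trans yb; exact: anc_up.
Qed.

(** Only path vertices can lose descendants: those of T(v) off the path keep theirs, and a proper
    ancestor of [v] is an ancestor of [x], below which T(v) now hangs. *)
Lemma collected_endpoints a b : Some a \in ancestors T (Some b) ->
  Some a \notin ancestors T' (Some b) ->
  Some a \in P /\ Some v \in ancestors T (Some b).
Proof.
move=> ab ab'; have [vb|vb] := boolP (Some v \in ancestors T (Some b)); last first.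
  by rewrite anc_reroot_out ?ab in ab'.
split=> //; apply: contraNT ab' => aP.
have [va|va] := boolP (Some v \in ancestors T (Some a)).
  exact: anc_reroot_off.
apply: anc_trans (anc_reroot_in vb); rewrite anc_reroot_out //.
have := anc_chain rT ab vb; rewrite (negPf va) orbF anc_Some => /orP[/eqP av|aTv].
  by rewrite -av anc_refl in va.
exact: anc_trans Tvx.
Qed.

End Reroot.

(** * Collected edges *)

Definition cross_free n (T : dfs_tree n) (G : {set edge n}) : Prop :=
  {in G, forall e, ~~ cross_edge T e}.

Definition degree n (G : {set edge n}) (a : 'I_n) : nat :=
  #|[set e in G | a \in val e]|.

Lemma edge_eq n (e : edge n) (a b : 'I_n) :
  a \in val e -> b \in val e -> a != b -> val e = [set a; b].
Proof.
move=> ae be ab; apply/esym/eqP; rewrite eqEcard (eqP (valP e)) cards2 ab andbT.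
by apply/subsetP => c /set2P[]->.
Qed.

Lemma leq_card_bigcup (I J : finType) (X : {set I}) (F : I -> {set J}) :
  #|\bigcup_(i in X) F i| <= \sum_(i in X) #|F i|.
Proof.
elim/big_ind2: _ => [|A a B b Aa Bb|//]; first by rewrite cards0.
exact: leq_trans (leq_card_setU _ _) (leq_add Aa Bb).
Qed.

Section Collected.
Variables (n : nat) (T : dfs_tree n) (v x y : 'I_n) (G : {set edge n}).
Hypothesis rT : rooted T.
Hypothesis vy : Some v \in ancestors T (Some y).
Hypothesis vNx : Some v \notin ancestors T (Some x).
Hypothesis Tvx : T v \in ancestors T (Some x).
Hypothesis yx : depth T (Some y) <= depth T (Some x).
Hypothesis GT : cross_free T G.
Variables (t d : nat).
Hypothesis t_gt0 : 0 < t.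
Hypothesis Gd : forall a, degree G a <= d.

Let T' := reroot T (Some v) y x.
Let C := [set f in G | cross_edge T' f].
Let gain a := depth T' (Some a) - depth T (Some a).
Let near := [set a | (Some a \in tree_path T (Some y) (Some v)) && (gain a < t)].
Let far := [set a | t <= gain a].
Let moved := [set b | 0 < gain b].

(** The old and new depths of [a] add up to at least [2 * depth T (Some y) + 1], as [x] is at least
    as deep as [y]. *)
Lemma gain_path a : Some a \in tree_path T (Some y) (Some v) ->
  2 * (depth T (Some y) - depth T (Some a)) < gain a.
Proof.
move=> aP; have := depth_reroot_on rT vy vNx Tvx yx aP; have := path_depth aP.
by rewrite -/T' /gain; nlia.
Qed.

Lemma card_near : #|near| <= t.
Proof.
have tE : t.-1.+1 = t by nlia.
pose h a : 'I_t.-1.+1 := inord (depth T (Some y) - depth T (Some a)).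
have hE a : a \in near -> h a = depth T (Some y) - depth T (Some a) :> nat.
  rewrite inE => /andP[/gain_path ? ?]; rewrite inordK //; nlia.
suff h_inj : {in near &, injective h}
  by rewrite -(card_in_imset h_inj) -[X in _ <= X]tE -[X in _ <= X]card_ord max_card.
move=> a b an bn /(congr1 val) /=; rewrite !hE //.
move: an bn; rewrite ![_ \in near]inE => /andP[aP _] /andP[bP _].
have := path_depth bP; have := path_depth aP.
move: aP bP; rewrite !in_path => /andP[ay _] /andP[by_ _] da db Ed.
have {}Ed : depth T (Some a) = depth T (Some b) by nlia.
by case: (anc_depth_inj rT ay by_ Ed).
Qed.

Lemma collected_sub : val @: C \subset
  [set [set q.1; q.2] | q in setX near moved]
    :|: \bigcup_(a in far) val @: [set e in G | a \in val e].
Proof.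
apply/subsetP => _ /imsetP[f fC ->].
move: fC; rewrite inE => /andP[fG]; rewrite /cross_edge negb_exists_in.
have := GT fG; rewrite negbK => /exists_inP[a af /forall_inP aT] /forall_inP/(_ a af).
rewrite negb_forall_in => /exists_inP[b bf ab'].
have [aP vb] := collected_endpoints rT vy vNx Tvx yx (aT b bf) ab'.
have ab : a != b by apply: contraNneq ab' => ->; exact: anc_refl.
have [far_a|near_a] := leqP t (gain a); apply/setUP; [right|left].
  apply/bigcupP; exists a; first by rewrite inE.
  by apply/imsetP; exists f; rewrite // inE fG.
apply/imsetP; exists (a, b); last exact: edge_eq.
rewrite in_setX [a \in near]inE [b \in moved]inE aP near_a /= subn_gt0.
exact: (depth_reroot_in rT vy vNx Tvx yx).
Qed.

Lemma gain_sum : \sum_a gain a =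
  \sum_a depth T' (Some a) - \sum_a depth T (Some a).
Proof.
by rewrite sumnB // => a _; exact: (depth_reroot rT vy vNx Tvx yx).
Qed.

(* Charge a collected edge to its upper endpoint when that endpoint gains at
   least [t] levels, and otherwise to its lower endpoint, which moves and has
   at most [t] such edges because the upper endpoint is then among the [t]
   lowest vertices of the reversed path. *)
Lemma card_collected :
  t * #|C| <= (t ^ 2 + d) * (\sum_a depth T' (Some a) - \sum_a depth T (Some a)).
Proof.
rewrite -gain_sum -(card_imset _ val_inj).
apply: leq_trans (leq_mul (leqnn t) (subset_leq_card collected_sub)) _.
apply: leq_trans (leq_mul (leqnn t) (leq_card_setU _ _)) _.
rewrite mulnDr mulnDl; apply: leq_add.
  rewrite -mulnn -mulnA leq_mul2l; apply/orP; right.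
  apply: leq_trans (leq_imset_card _ _) _; rewrite cardsX leq_mul ?card_near //.
  rewrite -sum1_card big_mkcond; apply: leq_sum => b _.
  by rewrite inE; case: ifP.
apply: leq_trans (leq_mul (leqnn t) _) _; first exact: leq_card_bigcup.
rewrite !big_distrr big_mkcond; apply: leq_sum => a _ /=.
case: ifP => // /[!inE] ta; rewrite mulnC leq_mul //.
by apply: leq_trans (leq_imset_card _ _) _; exact: Gd.
Qed.

End Collected.

Definition expanding n (G : {set edge n}) (k : nat) : Prop :=
  forall A B : {set 'I_n}, k <= #|A| -> k <= #|B| -> [disjoint A & B] ->
  exists e a b, [/\ e \in G, a \in A, b \in B, a \in val e & b \in val e].

(** * Depth of a DFS tree of an expanding graph *)

Section Stick.
Variables (n : nat) (T : dfs_tree n) (G : {set edge n}) (k : nat).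
Hypothesis rT : rooted T.
Hypothesis GT : cross_free T G.
Hypothesis Gk : expanding G k.
Hypothesis k_gt0 : 0 < k.

(** If both sets were large, expansion would give an edge between incomparable vertices, which is a
    cross edge. *)
Lemma expanding_comparable (A B : {set 'I_n}) :
  {in A & B, forall a b, ~~ tree_comparable T a b} -> k <= #|A| -> #|B| < k.
Proof.
move=> AB kA; rewrite ltnNge; apply/negP => kB.
have dAB : [disjoint A & B].
  rewrite disjoints_subset; apply/subsetP => a aA; rewrite inE; apply/negP => aB.
  by have := AB _ _ aA aB; rewrite /tree_comparable anc_refl.
have [e [a [b [eG aA bB ae be]]]] := Gk kA kB dAB.
have := GT eG; rewrite negbK => /exists_inP[c ce /forall_inP cT].
have := AB _ _ aA bB; have [ab|ab] := eqVneq a b; first by rewrite ab /tree_comparable anc_refl.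
have := edge_eq ae be ab => Ee; move: (cT a ae) (cT b be); rewrite /tree_comparable.
by move: ce; rewrite Ee => /set2P[]-> aa bb; rewrite ?aa ?bb ?orbT.
Qed.

Let below w := [set c : 'I_n | w \in ancestors T (Some c)].
Let cover (X : {set 'I_n}) :=
  [set z : 'I_n | [exists c in X, Some c \in ancestors T (Some z)]].

Lemma in_below w z : (z \in below w) = (w \in ancestors T (Some z)).
Proof. by rewrite [LHS]inE. Qed.

Lemma coverP (X : {set 'I_n}) z :
  reflect (exists2 c, c \in X & Some c \in ancestors T (Some z)) (z \in cover X).
Proof. by rewrite [_ \in cover X]inE; exact: exists_inP. Qed.

Lemma cover0 : cover set0 = set0.
Proof. by apply/setP=> z; rewrite in_set0; apply/coverP => -[c]; rewrite inE. Qed.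

(** Siblings have equal depth, so a common descendant would force them to coincide. *)
Lemma cover_incomparable w (X Y : {set 'I_n}) :
  {in X, forall c, T c = w} -> {in Y, forall c, T c = w} -> [disjoint X & Y] ->
  {in cover X & cover Y, forall a b, ~~ tree_comparable T a b}.
Proof.
move=> Xw Yw dXY a b /coverP[c cX ca] /coverP[d dY db].
have H (z : vertex n) : Some c \in ancestors T z -> Some d \in ancestors T z -> False.
  move=> cz dz; suff cd : c = d by move: (disjointFr dXY cX); rewrite cd dY.
  have Ecd : depth T (Some c) = depth T (Some d).
    by rewrite !(depth_Some rT) Xw ?Yw.
  by case: (anc_depth_inj rT cz dz Ecd).
by apply/negP => /orP[ab|ba]; [apply: (H (Some b)) => //; exact: anc_trans ab
  | apply: (H (Some a)) => //; exact: anc_trans ba].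
Qed.

(* Splitting the children of [w] into two groups: a minimal group covering at
   least [k] vertices covers fewer than [3k], and what it leaves is joined to
   it by no edge. *)
Lemma card_below w : (forall c, T c = w -> #|below (Some c)| < 2 * k) ->
  #|below w| <= 4 * k.
Proof.
move=> small; pose S := [set c | T c == w].
have below_sub (X : {set 'I_n}) : X \subset S -> #|below w| <= 1 + #|cover X| + #|cover (S :\: X)|.
  move=> XS; pose W := [set c | Some c == w].
  have W1 : #|W| <= 1.
    apply/card_le1_eqP => c d; rewrite !inE => /eqP cw /eqP dw.
    by case: (etrans cw (esym dw)).
  apply: (@leq_trans #|W :|: cover X :|: cover (S :\: X)|); last first.
    apply: leq_trans (leq_card_setU _ _) _; rewrite leq_add2r.
    by apply: leq_trans (leq_card_setU _ _) _; rewrite leq_add2r.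
  apply/subset_leq_card/subsetP => z; rewrite in_below => wz; rewrite !in_setU.
  have [zw|ne] := eqVneq (Some z) w; first by rewrite [z \in W]inE zw eqxx.
  have [|c Tc cz] := anc_child rT wz; first by rewrite eq_sym.
  have [cX|cX] := boolP (c \in X).
    have -> : z \in cover X by apply/coverP; exists c.
    by rewrite orbT.
  have -> : z \in cover (S :\: X); last by rewrite orbT.
  by apply/coverP; exists c => //; rewrite !inE cX Tc /=.
have [covS|covS] := ltnP #|cover S| k.
  have := below_sub set0 (sub0set _); rewrite setD0.
  by rewrite cover0 cards0; nlia.
pose Q (X : {set 'I_n}) := (X \subset S) && (k <= #|cover X|).
have QS : Q S by rewrite /Q subxx covS.
case: (arg_minnP (fun X : {set 'I_n} => #|X|) QS) => X /andP[XS kX] Xmin.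
have [c cX] : exists c, c \in X.
  apply/set0Pn/eqP => X0; move: kX; rewrite X0 leqNgt => /negP; apply.
  by rewrite cover0 cards0.
have Xw : {in X, forall d, T d = w} by move=> d /(subsetP XS); rewrite inE => /eqP.
have covXc : #|cover (X :\ c)| < k.
  rewrite ltnNge; apply/negP => kXc.
  have := Xmin (X :\ c); rewrite /Q kXc (subset_trans (subsetDl _ _) XS) => /(_ isT).
  by rewrite [in X in X <= _](cardsD1 c) cX; nlia.
have covX : #|cover X| < 3 * k.
  have : #|cover X| <= #|cover (X :\ c)| + #|below (Some c)|.
    apply: leq_trans (leq_card_setU _ _); apply/subset_leq_card/subsetP => z.
    case/coverP => d dX dz; rewrite in_setU in_below.
    have [<-|dc] := eqVneq d c; first by rewrite dz orbT.
    by apply/orP; left; apply/coverP; exists d; rewrite // !inE dc.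
  by have := small c (Xw c cX); nlia.
have rest : #|cover (S :\: X)| < k.
  apply: expanding_comparable kX; apply: (@cover_incomparable w) => //.
    by move=> d; rewrite !inE => /andP[_ /eqP].
  by rewrite disjoint_sym disjoints_subset; apply/subsetP => d; rewrite !inE => /andP[].
by have := below_sub X XS; nlia.
Qed.

(* Follow the tree down to the deepest [w] with at least [2k] descendants.
   Fewer than [k] vertices are incomparable to [w], so all but [5k] vertices
   lie on one path. *)
Lemma card_incomparable_pairs : #|incomparable_pairs T| <= 10 * k * n.
Proof.
(* If [n < 2 * k] the trivial bound [n * n] suffices; otherwise the root has [2 * k] descendants, so
   a deepest such [w] exists. *)
have [small|large] := ltnP n (2 * k).
  have : #|incomparable_pairs T| <= n * n by rewrite (leq_trans (max_card _)) // card_prod card_ord.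
  by (simpl in *; nia).
pose Q w := 2 * k <= #|below w|.
have Q0 : Q None.
  rewrite /Q (_ : below None = [set: 'I_n]) ?cardsT ?card_ord //.
  by apply/setP => c; rewrite in_below in_setT; exact: rT.
case: (arg_maxnP (depth T) Q0) => w Qw wmax.
have bw : #|below w| <= 4 * k.
  apply: card_below => c Tc; rewrite ltnNge; apply/negP => /wmax.
  by rewrite (depth_Some rT) Tc; nlia.
pose U := [set u : 'I_n | (w \notin ancestors T (Some u)) && (Some u \notin ancestors T w)].
have cU : #|U| < k.
  apply: (@expanding_comparable (below w)); last by apply: leq_trans Qw; rewrite leq_pmull.
  move=> z u; rewrite in_below => wz; rewrite [u \in _]inE => /andP[wu uw].
  apply/negP => /orP[zu|uz].
    by rewrite (anc_trans wz zu) in wu.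
  by have := anc_chain rT wz uz; rewrite (negPf wu) (negPf uw).
pose V := U :|: below w.
have cV : #|V| <= 5 * k.
  apply: leq_trans (leq_card_setU _ _) _.
  by rewrite (_ : 5 * k = k + 4 * k) ?leq_add ?(ltnW cU) //; lia.
have : #|incomparable_pairs T| <= #|setX V [set: 'I_n]| + #|setX [set: 'I_n] V|.
  apply: leq_trans (leq_card_setU _ _).
  apply/subset_leq_card/subsetP => -[a b].
  rewrite inE /= => ab; rewrite in_setU !in_setX !in_setT /= andbT.
  have cmp c : c \notin V -> Some c \in ancestors T w.
    rewrite in_setU negb_or in_below => /andP[Uc wc]; apply: contraR Uc => cw.
    by rewrite inE wc cw.
  apply: contraR ab; rewrite negb_or => /andP[/cmp aw /cmp b_w].
  exact: anc_chain aw b_w.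
move/leq_trans; apply; rewrite !cardsX cardsT card_ord [n * _]mulnC addnn.
by rewrite -mul2n mulnA leq_mul2r (_ : 10 * k = 2 * (5 * k)) ?leq_mul2l ?cV ?orbT; lia.
Qed.

End Stick.

(** * Processing one waiting edge *)

Lemma other_endP n (e : edge n) x : x \in val e ->
  other_end e x \in val e /\ other_end e x != x.
Proof.
move=> xe; rewrite /other_end; case: pickP => [y /andP[]//|no].
have := eqP (valP e); rewrite (cardsD1 x) xe => /eqP; rewrite eqSS => /cards1P[y ey].
have : y \in sval e :\ x by rewrite ey inE.
by rewrite !inE => /andP[yx ye]; have := no y; rewrite ye yx.
Qed.

Definition total_depth n (T : dfs_tree n) : nat := \sum_a depth T (Some a).

Section Run.
Variables (n : nat) (p : policy n).
Implicit Types (S : state n).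

Definition dfs_invariant S : Prop :=
  rooted (tree S) /\ cross_free (tree S) (graph S).

Definition workload S : nat := nprocessed S + #|waiting S|.

(** The growth of the total depth pays for the collected edges; [t] and [d] stay free so that they
    can follow the density of the graph. *)
Lemma process_spec S : dfs_invariant S -> waiting S != set0 ->
  let S' := process p S in
  [/\ dfs_invariant S', graph S' :|: waiting S' = graph S :|: waiting S,
      inserted S' = inserted S /\ upcoming S' = upcoming S,
      nchanged S <= nchanged S' /\
      nchanged S' + total_depth (tree S) <= nchanged S + total_depth (tree S') &
      forall t d, 0 < t -> (forall a, degree (graph S) a <= d) ->
        t * workload S' <= t * workload S +
          (t ^ 2 + d) * (total_depth (tree S') - total_depth (tree S))].
Proof.
case: S => h up0 T G Q np nc [/= rT GT] Q0; rewrite /process /=.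
set e := next_edge p h T Q; set x := lower_end p h T Q e; set y := other_end e x.
have eQ : e \in Q := next_edge_in p h T Q0.
have xe : x \in val e := lower_end_in p h T Q e.
have [ye yx] := other_endP xe; rewrite -/y in ye yx.
have dyx := lower_end_depth p h T Q ye; rewrite -/x in dyx.
have Ee : val e = [set x; y] by rewrite (edge_eq xe ye) // eq_sym.
have cQ : #|Q| = (#|Q :\ e|).+1 by rewrite (cardsD1 e) eQ.
have [wx wy wmax] := lcaP rT (Some x) (Some y).
set w := lca T (Some x) (Some y) in wx wy wmax *.
case: ifP => [wxy|wxy] /=.
  split=> //.
  - split=> //= f; rewrite !inE => /orP[/eqP->|/GT//].
    rewrite negbK; apply/exists_inP; move: wxy; rewrite !inE => /orP[] /eqP wE.
      exists x => //; apply/forall_inP => b; rewrite Ee => /set2P[]->; first exact: anc_refl.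
      by rewrite -wE.
    exists y => //; apply/forall_inP => b; rewrite Ee => /set2P[]->; last exact: anc_refl.
    by rewrite -wE.
  - apply/setP => f; rewrite !inE; have [->|fe] := eqVneq f e; first by rewrite eQ orbT.
    by case: (f \in G).
  - by move=> t d _ _; rewrite /workload /= cQ addSnnS leq_addr.
have wNx : w != Some x by apply: contraFneq wxy => ->; rewrite !inE eqxx.
have wNy : w != Some y by apply: contraFneq wxy => ->; rewrite !inE eqxx orbT.
have [v [-> Tv vy]] := child_towardP rT wy wNy.
have vNx : Some v \notin ancestors T (Some x).
  apply/negP => vx; have := wmax _ vx vy.
  by rewrite (depth_Some rT) Tv ltnn.
have Tvx : T v \in ancestors T (Some x) by rewrite Tv.
set T' := reroot T (Some v) y x.
set C := [set f in G | cross_edge T' f].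
have CG : C \subset G by apply/subsetP => f; rewrite inE => /andP[].
have rT' : rooted T' by exact: reroot_rooted.
split=> //=.
- split=> //= f; rewrite in_setU1 => /orP[/eqP->|].
    rewrite negbK; apply/exists_inP; exists x => //; apply/forall_inP => b.
    rewrite Ee => /set2P[]->; first exact: anc_refl.
    by rewrite anc_Some reroot_end anc_refl orbT.
  by rewrite !inE negb_and => /andP[/orP[/negPf->|]].
- apply/setP => f; rewrite !inE; have [->|fe] := eqVneq f e; first by rewrite eQ orbT.
  by case: (f \in G); case: (f \in Q); case: (cross_edge T' f).
- by rewrite leq_addr -addnA leq_add2l; split=> //; exact: changed_reroot.
move=> t d t0 Gd; have := card_collected rT vy vNx Tvx dyx GT t0 Gd.
rewrite -/T' -/C /workload /total_depth /= => H.
rewrite cQ addSnnS; apply: leq_trans (_ : t * (np + (#|Q :\ e| + #|C|).+1) <= _).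
  by rewrite leq_mul2l leq_add2l ltnS leq_card_setU orbT.
by rewrite -addSn addnA mulnDr leq_add2l.
Qed.

End Run.

(** * Accounting along a run *)

Lemma degree_sub n (G H : {set edge n}) a : G \subset H -> degree G a <= degree H a.
Proof.
move=> GH; apply/subset_leq_card/subsetP => f; rewrite !inE => /andP[fG ->].
by rewrite (subsetP GH).
Qed.

Lemma total_depth_le n (T : dfs_tree n) : rooted T -> 2 * total_depth T <= n ^ 2 + n.
Proof. by move=> rT; rewrite -(double_depth_sum rT) leq_addr. Qed.

Lemma initial_rooted n : rooted ([ffun=> None] : dfs_tree n).
Proof. by case=> [a|]; rewrite ?anc_Some ?ffunE anc_None ?eqxx ?orbT. Qed.

(* Levels [r < R] start after [N r] insertions.  On level [r] the graph is
   expanding for [k r], so that twice the total depth can only grow by [10 * k r * n] from then on.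
   After [j] insertions, at most [theta j] edges are collected per unit of growth
   of the total depth. *)
Section Accounting.
Variables (n : nat) (p : policy n) (es : seq (edge n)).
Variables (R K : nat) (N k : nat -> nat).

Let inserted_set j : {set edge n} := [set e in take j es].
Let theta j := K * (1 + \sum_(r < R | N r < j) 2 ^ r).

Hypothesis theta_cost : forall j, j <= size es -> exists t d,
  [/\ 0 < t, forall a, degree (inserted_set j) a <= d & t ^ 2 + d <= t * theta j].
Hypothesis k_gt0 : forall r, 0 < k r.
Hypothesis expanding_levels : forall r, r < R -> N r < size es ->
  expanding (inserted_set (N r)) (k r).

(** The excess of twice the total depth over the floor [n ^ 2 + n - 10 * k r * n] of level [r]; the
    truncated subtraction is exact once that floor is reached. *)
Let slack (T : dfs_tree n) r := 2 * total_depth T + 10 * k r * n - (n ^ 2 + n).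
Let potential (T : dfs_tree n) j :=
  K * (total_depth T + \sum_(r < R | N r < j) 2 ^ r * slack T r).

Definition run_invariant (S : state n) : Prop :=
  let j := size (inserted S) in
  [/\ dfs_invariant S, graph S :|: waiting S = [set e in inserted S],
      inserted S ++ upcoming S = es,
      nchanged S <= total_depth (tree S) &
      (forall r, r < R -> N r < j ->
         n ^ 2 + n <= 2 * total_depth (tree S) + 10 * k r * n) /\
      workload S <= j + potential (tree S) j].

(** Each active slack grows by twice the growth of the total depth, hence by at least the share of
    its level in [theta]. *)
Lemma potential_grows T T' j : total_depth T <= total_depth T' ->
  (forall r, r < R -> N r < j -> n ^ 2 + n <= 2 * total_depth T + 10 * k r * n) ->
  potential T j + theta j * (total_depth T' - total_depth T) <= potential T' j.
Proof.
move=> TT' low; set D := total_depth T' - total_depth T.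
have TD : total_depth T' = total_depth T + D by rewrite subnKC.
rewrite /theta -mulnA -mulnDr leq_mul2l mulnDl mul1n TD addnACA leq_add2l; apply/orP; right.
rewrite big_distrl -big_split; apply: leq_sum => r Nr /=.
rewrite -mulnDr leq_mul2l /slack TD; apply/orP; right.
by have := low r (ltn_ord r) Nr; lia.
Qed.

Lemma potential_mono T i j : i <= j -> potential T i <= potential T j.
Proof.
move=> ij; rewrite /potential leq_mul2l leq_add2l; apply/orP; right.
rewrite big_mkcond [leqRHS]big_mkcond; apply: leq_sum => r _.
by case: ltnP => // Nr; rewrite (leq_trans Nr).
Qed.

Lemma step_invariant S : run_invariant S -> run_invariant (step p S).
Proof.
case=> inv GQ Ees nc [low wl]; rewrite /step.
have jes : size (inserted S) <= size es by rewrite -Ees size_cat leq_addr.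
have Eset : inserted_set (size (inserted S)) = [set e in inserted S].
  by rewrite /inserted_set -Ees take_size_cat.
case: ifP => [Q0|/negbFE/eqP Q0].
  have /= [inv' GQ' [hE uE] [nc1 nc2] cost] := process_spec p inv Q0.
  set S' := process p S in inv' GQ' hE uE nc1 nc2 cost *.
  have [t [d [t0 Gd td]]] := theta_cost jes.
  have le_td : total_depth (tree S) <= total_depth (tree S') by lia.
  rewrite /run_invariant hE uE; split=> //; [by rewrite GQ' | by lia | split].
    by move=> r rR Nr; apply: leq_trans (low r rR Nr) _; lia.
  apply: leq_trans (leq_add (leqnn _) (potential_grows le_td low)).
  rewrite addnA; apply: leq_trans (leq_add wl (leqnn _)).
  have Sd a : degree (graph S) a <= d.
    by apply: leq_trans (Gd a); apply: degree_sub; rewrite Eset -GQ subsetUl.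
  rewrite -(leq_pmul2l t0) mulnDr; apply: leq_trans (cost t d t0 Sd) _.
  by rewrite leq_add2l mulnA leq_mul2r td orbT.
case E: (upcoming S) => [|e es']; first by split; rewrite // E in Ees *.
rewrite Q0 setU0 in GQ.
rewrite /run_invariant /= size_rcons; split=> //.
- by rewrite GQ; apply/setP => f; rewrite !inE mem_rcons inE orbC.
- by rewrite cat_rcons -E.
have [rS cf] := inv; split=> [r rR|]; last first.
  have := leq_trans wl (leq_add (leqnn _) (potential_mono (tree S) (leqnSn _))).
  by rewrite /workload /= Q0 cards0 cards1 addn0; lia.
(* A level that starts with this insertion: no edge is waiting, so the tree is a DFS tree of exactly
   the first [N r] edges, and expansion supplies the floor. *)
rewrite ltnS leq_eqVlt => /orP[/eqP Nr|/(low r rR)//].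
rewrite -(double_depth_sum rS) leq_add2l.
apply: card_incomparable_pairs cf _ (k_gt0 r) => //.
rewrite GQ -Eset -Nr; apply: expanding_levels => //.
by rewrite Nr -Ees size_cat E /=; lia.
Qed.

Lemma run_invariantP i : run_invariant (run p es i).
Proof.
elim: i => [|i IH]; last by rewrite /run iterS; exact: step_invariant.
split=> //=.
- by split=> [|f]; [exact: initial_rooted | rewrite inE].
- by apply/setP => f; rewrite !inE.
- by rewrite /workload cards0.
Qed.

(** Twice the total depth never exceeds [n ^ 2 + n], so each slack is at most [10 * k r * n]. *)
Lemma run_nprocessed i : nprocessed (run p es i) <= size es +
  K * (n ^ 2 + \sum_(r < R | N r < size es) 2 ^ r * (10 * k r * n)).
Proof.
have [[rT _] _ Ees _ [_ wl]] := run_invariantP i.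
have jes : size (inserted (run p es i)) <= size es by rewrite -[in leqRHS]Ees size_cat leq_addr.
have := total_depth_le rT => tdn.
apply: leq_trans (leq_addr _ _) (leq_trans wl _).
apply: leq_add jes (leq_trans (potential_mono _ jes) _).
rewrite /potential leq_mul2l; apply/orP; right; apply: leq_add.
  have nn : n <= n ^ 2 by rewrite -mulnn; case: (n) => // m; rewrite leq_pmulr.
  by move: tdn nn; set D := total_depth _; lia.
by apply: leq_sum => r _; rewrite leq_mul2l /slack; apply/orP; right; lia.
Qed.

Lemma run_nchanged i : nchanged (run p es i) <= n ^ 2 + n.
Proof.
have [[rT _] _ _ nc _] := run_invariantP i.
by have := total_depth_le rT; set D := total_depth _ in nc *; lia.
Qed.

End Accounting.

(** * Random permutations *)

Section RandomPermutation.
Variable T : finType.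
Implicit Types (A F : {set T}) (s : {perm T}).

(* Composing with a transposition shows that all positions outside [A] carry an
   element of [F] equally often. *)
Lemma card_perm_hit A F e : e \notin A ->
  #|F| * #|[set s : {perm T} | [disjoint s @: A & F]]| <=
  #|T| * #|[set s : {perm T} | [disjoint s @: A & F] && (s e \in F)]|.
Proof.
move=> eA; set Z := [set s | _].
have swap e' : e' \notin A ->
    #|[set s in Z | s e' \in F]| <= #|[set s in Z | s e \in F]|.
  move=> e'A; rewrite -(card_imset _ (mulgI (tperm e e'))).
  apply/subset_leq_card/subsetP => _ /imsetP[s /[!inE] /andP[sA se'] ->].
  rewrite permM tpermL se' andbT (_ : _ @: A = s @: A) //.
  apply: eq_in_imset => a aA; rewrite permM tpermD //.
    by apply: contraNneq eA => ->.
  by apply: contraNneq e'A => ->.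
(* Double counting: when [s] keeps [F] off the positions [A], all elements of [F] sit at positions
   outside [A]. *)
have -> : #|F| * #|Z| = \sum_(e' | e' \notin A) #|[set s in Z | s e' \in F]|.
  under eq_bigr do rewrite -sum1dep_card.
  rewrite (exchange_big_dep (mem Z)) /=; last by move=> e' s _ /andP[].
  rewrite mulnC -sum_nat_const; apply: eq_bigr => s /[!inE] sA.
  rewrite sum1dep_card -(card_preimset F (@perm_inj _ s)).
  apply: eq_card => e'; rewrite !inE sA /= andbC.
  case sF: (s e' \in F) => //=; apply/esym/negP => e'A.
  by move: (disjointFl sA sF); rewrite imset_f.
apply: leq_trans (leq_sum _ (fun e' e'A => swap e' e'A)) _.
rewrite sum_nat_const leq_mul ?max_card //; apply: subset_leq_card.
by apply/subsetP => s; rewrite !inE.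
Qed.

(** Positions are added one at a time; given that the earlier ones avoid [F], the next hits it with
    probability at least [#|F| / #|T|]. *)
Lemma card_perm_avoid A F :
  #|[set s : {perm T} | [disjoint s @: A & F]]| * #|T| ^ #|A| <=
  (#|T| - #|F|) ^ #|A| * #|{perm T}|.
Proof.
have [m] := ubnP #|A|; elim: m A => // m IH A.
have [->|[e eA]] := set_0Vmem A; first by rewrite cards0 !expn0 muln1 mul1n max_card.
rewrite (cardsD1 e) eA add1n ltnS => {}/IH; set A' := A :\ e => IH.
have e_A' : e \notin A' by rewrite !inE eqxx.
have hit := card_perm_hit F e_A'.
set Z' := #|[set s : {perm T} | [disjoint s @: A' & F]]| in IH hit.
set X := #|[set s : {perm T} | _ && _]| in hit.
have -> : #|[set s : {perm T} | [disjoint s @: A & F]]| = Z' - X.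
  rewrite /Z' /X -cardsDS; last by apply/subsetP => s; rewrite !inE => /andP[].
  apply: eq_card => s; rewrite !inE -(setD1K eA) imsetU1.
  rewrite -setI_eq0 setIUl setU_eq0 setI_eq0 disjoints1 -/A' setI_eq0.
  by case: (s e \in F); case: [disjoint _ & _].
have F_T : #|F| <= #|T| := max_card _.
rewrite !expnS mulnA -mulnA; apply: leq_trans (_ : (#|T| - #|F|) * (Z' * #|T| ^ #|A'|) <= _).
  rewrite !mulnA leq_mul2r mulnBl [X in _ <= X]mulnBl [_ * #|T|]mulnC [X * _]mulnC.
  by rewrite leq_sub2l ?orbT.
by rewrite -mulnA leq_mul2l IH orbT.
Qed.

(* [s] covers [F] with the positions [A] iff [s^-1] sends no element of [F] outside
   [A]. *)
Lemma card_perm_contain A F :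
  #|[set s : {perm T} | F \subset s @: A]| * #|T| ^ #|F| <= #|A| ^ #|F| * #|{perm T}|.
Proof.
have cA : #|T| - #|~: A| = #|A| by rewrite [#|~: A|]cardsCs setCK subKn ?max_card.
have := card_perm_avoid F (~: A); rewrite cA -(card_imset _ invg_inj).
apply: leq_trans; rewrite leq_mul2r; apply/orP; right.
apply/subset_leq_card/subsetP => s; rewrite inE => FsA.
apply/imsetP; exists s^-1%g; last by rewrite invgK.
rewrite inE disjoints_subset setCK; apply/subsetP => _ /imsetP[f fF ->].
by have /imsetP[a aA ->] := subsetP FsA _ fF; rewrite permK.
Qed.

End RandomPermutation.

(** * Counting edges of the complete graph *)

Lemma card_edge n : #|{: edge n}| = 'C(n, 2).
Proof. by rewrite card_sig -[in RHS](card_ord n) -card_draws; apply: eq_card => A; rewrite !inE. Qed.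

Definition incident n (a : 'I_n) : {set edge n} :=
  [set e : edge n | a \in val e].

Lemma card_incident n (a : 'I_n) : #|incident a| <= n.-1.
Proof.
have -> : n.-1 = #|[set b : 'I_n | b != a]|.
  by have := cardsC1 a; rewrite card_ord => <-; apply: eq_card => b; rewrite !inE.
have inj : {in incident a &, injective (fun e : edge n => other_end e a)}.
  move=> e f; rewrite !inE => ae af Eef; apply: val_inj => /=.
  have [ee ea] := other_endP ae; have [fe fa] := other_endP af.
  rewrite (edge_eq ae ee) 1?eq_sym // (edge_eq af fe) 1?eq_sym //.
  by rewrite Eef.
rewrite -(card_in_imset inj); apply/subset_leq_card/subsetP => _ /imsetP[e ae ->].
by rewrite !inE in ae *; have [] := other_endP ae.
Qed.

Definition joining n (A B : {set 'I_n}) : {set edge n} :=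
  [set e : edge n | [exists a in A, [exists b in B, (a \in val e) && (b \in val e)]]].

Lemma card_joining n (A B : {set 'I_n}) : [disjoint A & B] ->
  #|A| * #|B| <= #|joining A B|.
Proof.
move=> dAB; rewrite -cardsX -(card_imset (joining A B) val_inj).
have inj : {in setX A B &, injective (fun q : 'I_n * 'I_n => [set q.1; q.2])}.
  move=> [a b] [c d] /setXP[/= aA bB] /setXP[/= cA dB] E.
  have ne u w : u \in A -> w \in B -> u == w = false.
    by move=> uA wB; apply/eqP => uw; have := disjointFr dAB uA; rewrite uw wB.
  have := set21 a b; rewrite E !inE (ne a d) // orbF => /eqP->.
  by have := set22 a b; rewrite E !inE [b == c]eq_sym (ne c b) // => /eqP->.
rewrite -(card_in_imset inj); apply/subset_leq_card/subsetP.
move=> _ /imsetP[[a b] /setXP[/= aA bB] ->].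
have ab : #|[set a; b]| == 2.
  suff ne : a != b by rewrite cards2 ne.
  by apply/eqP => E; have := disjointFr dAB aA; rewrite E bB.
apply/imsetP; exists (exist _ [set a; b] ab) => //; rewrite inE.
by apply/exists_inP; exists a => //; apply/exists_inP; exists b => //=; rewrite set21 set22.
Qed.

Lemma card_bigcup_mul (I J : finType) (X : {set I}) (F : I -> {set J}) c d :
  {in X, forall i, #|F i| * c <= d} -> #|\bigcup_(i in X) F i| * c <= #|X| * d.
Proof.
move=> Fd; apply: leq_trans (leq_mul (leq_card_bigcup _ _) (leqnn c)) _.
by rewrite big_distrl -sum_nat_const; apply: leq_sum.
Qed.

(** * Good insertion orders *)

Lemma leq_exp m1 m2 e : m1 <= m2 -> m1 ^ e <= m2 ^ e.
Proof. by case: e => // e le_m; rewrite leq_exp2r. Qed.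

(** This is [(1 - x) ^ i * (1 + i * x) <= 1] for [x = f / M], cleared of denominators; at [i = q]
    the second factor is at least 2. *)
Lemma bernoulli_half M f q : 0 < M -> f <= M -> M <= q * f -> 2 * (M - f) ^ q <= M ^ q.
Proof.
move=> M0 fM Mqf.
have H i : (M - f) ^ i * (M + i * f) <= M ^ i * M.
  elim: i => [|i IH]; first by rewrite !expn0 addn0.
  rewrite !expnS; apply: leq_trans (_ : M * ((M - f) ^ i * (M + i * f)) <= _); last first.
    by rewrite -mulnA leq_mul2l IH orbT.
  rewrite [(M - f) * _]mulnC -mulnA [leqRHS]mulnCA leq_mul2l; apply/orP; right.
  by have ME := subnK fM; move: (M - f) ME => g <-; nia.
rewrite -(leq_pmul2r M0); apply: leq_trans (H q); rewrite -mulnA mulnCA leq_mul2l; lia.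
Qed.

Lemma ffact_le_exp m i : m ^_ i <= m ^ i.
Proof.
rewrite ffact_prod -[in m ^ i](card_ord i) -prod_nat_const.
by apply: leq_prod => j _; exact: leq_subr.
Qed.

(** A weak Stirling bound: the factorial times ['C(i + i, i)] is a product of [i] factors, each at
    least [i], and counting subsets bounds the binomial by [4 ^ i]. *)
Lemma exp_le_fact i : i ^ i <= 4 ^ i * i`!.
Proof.
have Ci : 'C(i + i, i) <= 4 ^ i.
  have -> : 'C(i + i, i) = #|[set A : {set 'I_(i + i)} | #|A| == i]|.
    by rewrite card_draws card_ord.
  apply: leq_trans (max_card _) _; rewrite -cardsT -powersetT card_powerset cardsT.
  by rewrite card_ord addnn -mul2n expnM.
apply: leq_trans (leq_mul Ci (leqnn _)); rewrite bin_ffact ffact_prod.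
have -> : i ^ i = \prod_(j < i) i by rewrite prod_nat_const card_ord.
by apply: leq_prod => j _; have := ltn_ord j; lia.
Qed.

Lemma subset_of_card (T : finType) (A : {set T}) k :
  k <= #|A| -> exists2 B : {set T}, B \subset A & #|B| = k.
Proof.
move=> kA; exists [set x in take k (enum A)].
  by apply/subsetP => x; rewrite inE => /mem_take; rewrite mem_enum.
rewrite cardsE (card_uniqP _) ?take_uniq ?enum_uniq // size_take -cardE.
by case: ltngtP kA.
Qed.

Definition positions n j : {set edge n} := [set e in take j (enum {: edge n})].

Lemma card_positions n j : #|positions n j| = minn j #|{: edge n}|.
Proof.
by rewrite cardsE (card_uniqP _) ?take_uniq ?enum_uniq // size_take_min cardE.
Qed.

Lemma first_edges_set n m (s : {perm edge n}) j : j <= m ->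
  [set e in take j (first_edges m s)] = s @: positions n j.
Proof.
move=> jm; rewrite /first_edges take_takel // -map_take; apply/setP => e.
rewrite inE; apply/mapP/imsetP => -[f fe ->]; exists f => //.
  by rewrite inE.
by rewrite inE in fe.
Qed.

Section GoodOrders.
Variables n L tau : nat.
Hypothesis n_gt1 : 1 < n.
Hypothesis nL : n <= 2 ^ L.
Hypothesis L_gt0 : 0 < L.
Hypothesis Ltau : L <= tau ^ 2.

Let M := #|{: edge n}|.

(* On level [r], with [t = tau * 2 ^ r], the graph has at most [n * t ^ 2] edges and
   degrees at most [32 * t ^ 2]. *)
Definition level r := 4 ^ r * (n * tau ^ 2).
Definition degree_bound r := 32 * (4 ^ r * tau ^ 2).
(** Rounded up past [4 * n / 4 ^ r], so that [set_bound r * level r] is at least [4 * n ^ 2 * L]. *)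
Definition set_bound r := (4 * n) %/ 4 ^ r + 1.

Definition dense_orders r : {set {perm edge n}} :=
  \bigcup_(a in [set: 'I_n])
    \bigcup_(X in [set X : {set edge n} | (X \subset incident a) && (#|X| == degree_bound r)])
      [set s : {perm edge n} | X \subset s @: positions n (level r)].

Definition sparse_orders r : {set {perm edge n}} :=
  \bigcup_(q in [set q : {set 'I_n} * {set 'I_n} |
      [&& #|q.1| == set_bound r, #|q.2| == set_bound r & [disjoint q.1 & q.2]]])
    [set s : {perm edge n} | [disjoint s @: positions n (level r) & joining q.1 q.2]].

Lemma twoM : 2 * M = n * n.-1.
Proof. by rewrite /M card_edge mulnC -[2]/(2`!) bin_ffact ffactnS ffactn1. Qed.

Lemma M_gt0 : 0 < M.
Proof. by rewrite /M card_edge bin_gt0. Qed.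

Lemma tau_gt0 : 0 < tau.
Proof. by case: tau Ltau => //; rewrite leqNgt L_gt0. Qed.

Lemma card_dense_orders r : #|dense_orders r| * 4 ^ L <= #|{perm edge n}|.
Proof.
set D := degree_bound r; set N := level r; set P := #|{perm _}|.
have Dgt0 : 0 < D by rewrite /D /degree_bound !muln_gt0 !expn_gt0 tau_gt0.
have bad : #|dense_orders r| * M ^ D <= n * ('C(n.-1, D) * (N ^ D * P)).
  apply: leq_trans (card_bigcup_mul (d := 'C(n.-1, D) * (N ^ D * P)) _) _; last first.
    by rewrite cardsT card_ord.
  move=> a _; apply: leq_trans (card_bigcup_mul (d := N ^ D * P) _) _; last first.
    by rewrite cards_draws leq_mul2r leq_bin2l ?orbT // card_incident.
  move=> X; rewrite inE => /andP[_ /eqP XD]; rewrite -/D in XD.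
  have := card_perm_contain (positions n N) X; rewrite XD => /leq_trans; apply.
  by rewrite leq_mul2r leq_exp2r ?card_positions ?geq_minl ?orbT.
(* Since the factorial of [D] is at least [(D / 4) ^ D], this identity bounds the probability by
   [n / 4 ^ D], which [nD] turns into [1 / 4 ^ L]. *)
have MD : M * D = 16 * (N * n.-1).
  by rewrite /D /N /degree_bound /level; have := twoM; move: (4 ^ r) (tau ^ 2) => u w; nia.
have nD : n * 4 ^ L <= 4 ^ D.
  apply: leq_trans (leq_mul nL (leqnn _)) _.
  rewrite -[4]/(2 ^ 2) -!expnM -expnD leq_exp2l // /D /degree_bound.
  have : 0 < 4 ^ r by rewrite expn_gt0.
  by move: Ltau; move: (4 ^ r) (tau ^ 2) => u w; nia.
have D0 : 0 < M ^ D * D`! * 4 ^ D by rewrite !muln_gt0 !expn_gt0 fact_gt0 M_gt0.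
rewrite -(leq_pmul2r D0).
apply: leq_trans (_ : n * 4 ^ L * ('C(n.-1, D) * D`!) * N ^ D * 4 ^ D * P <= _).
  have := leq_mul bad (leqnn (4 ^ L * (D`! * 4 ^ D))).
  move: (#|dense_orders r|) (M ^ D) (4 ^ L) (D`!) (4 ^ D) ('C(n.-1, D)) (N ^ D) => *; lia.
apply: leq_trans (_ : 4 ^ D * n.-1 ^ D * N ^ D * 4 ^ D * P <= _).
  rewrite !leq_mul // bin_ffact; exact: ffact_le_exp.
rewrite [leqRHS]mulnC leq_mul2r; apply/orP; right.
have -> : 4 ^ D * n.-1 ^ D * N ^ D * 4 ^ D = M ^ D * D ^ D.
  by rewrite -!expnMn MD; congr (_ ^ _); lia.
by rewrite -mulnA leq_mul2l [D`! * _]mulnC exp_le_fact orbT.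
Qed.

Lemma card_sparse_orders r : level r <= M -> #|sparse_orders r| * 4 ^ L <= #|{perm edge n}|.
Proof.
move=> NM; set N := level r in NM; set k := set_bound r; set P := #|{perm _}|.
have cN : #|positions n N| = N by rewrite card_positions; apply/minn_idPl.
have k0 : 0 < k by rewrite /k /set_bound addn1.
(* The part [2 * k * L] pays for the at most [2 ^ (2 * k * L)] pairs of sets, and [2 * L] leaves the
   factor [4 ^ L]. *)
pose J := 2 * k * L + 2 * L.
have pair q : q \in [set q : {set 'I_n} * {set 'I_n} |
      [&& #|q.1| == k, #|q.2| == k & [disjoint q.1 & q.2]]] ->
   #|[set s : {perm edge n} | [disjoint s @: positions n N & joining q.1 q.2]]| * 2 ^ J <= P.
  rewrite inE => /and3P[/eqP q1 /eqP q2 dq].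
  have := card_joining dq; rewrite q1 q2; set F := joining _ _; set f := #|F| => kf.
  have fM : f <= M by exact: max_card.
  have f0 : 0 < f by apply: leq_trans kf; rewrite muln_gt0 k0.
  (* Every [i] positions contribute a factor of at most one half, and the first [N] positions
     contain [J] blocks of length [i]. *)
  have [i Mif if2] : exists2 i, M <= i * f & i * f <= 2 * M.
    exists (M %/ f).+1; first by rewrite ltnW // ltn_ceil.
    by rewrite mul2n -addnn mulSn leq_add // leq_trunc_div.
  have iJN : i * J <= N.
    have kn : 4 * n <= k * 4 ^ r by rewrite /k /set_bound addn1 ltnW // ltn_ceil // expn_gt0.
    have kN : 8 * M * L <= N * k.
      have := twoM; have : n.-1 <= n by exact: leq_pred.
      move: kn Ltau; rewrite /N /level; move: (4 ^ r) (tau ^ 2) => u w kn Lw n1 M2.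
      apply: leq_trans (_ : 4 * n * n * w <= _); nia.
    have JL : J <= 4 * k * L by rewrite /J; nia.
    rewrite -(leq_pmul2r f0) mulnAC.
    apply: leq_trans (_ : 2 * M * (4 * k * L) <= _); first exact: leq_mul.
    apply: leq_trans (_ : N * (k * k) <= _); last by rewrite leq_mul.
    by rewrite mulnA; apply: leq_trans (_ : 8 * M * L * k <= _); nia.
  have half := bernoulli_half M_gt0 fM Mif.
  have pow : 2 ^ J * (M - f) ^ N <= M ^ N.
    move: (J) iJN => j ijN; rewrite -(subnKC ijN) !expnD mulnA; apply: leq_mul; last first.
      exact/leq_exp/leq_subr.
    by rewrite !expnM -expnMn; exact: leq_exp.
  have := card_perm_avoid (positions n N) F; rewrite cN -/M -/f -/P => av.
  have MN0 : 0 < M ^ N by rewrite expn_gt0 M_gt0.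
  rewrite -(leq_pmul2r MN0) mulnAC.
  apply: leq_trans (leq_mul av (leqnn _)) _.
  by rewrite mulnAC [P * _]mulnC leq_mul2r [_ * 2 ^ J]mulnC pow orbT.
have := card_bigcup_mul pair; rewrite -/(sparse_orders r) => bad.
have pairs : #|[set q : {set 'I_n} * {set 'I_n} |
      [&& #|q.1| == k, #|q.2| == k & [disjoint q.1 & q.2]]]| <= 2 ^ (2 * k * L).
  apply: leq_trans (_ : #|setX [set A : {set 'I_n} | #|A| == k] [set A : {set 'I_n} | #|A| == k]| <= _).
    by apply/subset_leq_card/subsetP => q; rewrite !inE => /and3P[-> ->].
  have Ck : 'C(n, k) <= 2 ^ (k * L).
    apply: leq_trans (_ : n ^ k <= _).
      by apply: leq_trans (ffact_le_exp _ _); rewrite -bin_ffact leq_pmulr // fact_gt0.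
    by rewrite [k * L]mulnC expnM; exact: leq_exp.
  by rewrite cardsX card_draws card_ord -mulnA mul2n -addnn expnD leq_mul.
have J0 : 0 < 2 ^ (2 * k * L) by rewrite expn_gt0.
rewrite -(leq_pmul2r J0) -mulnA -[4]/(2 ^ 2) -expnM -expnD addnC -/J.
by apply: leq_trans bad _; rewrite mulnC leq_mul2l pairs orbT.
Qed.

Lemma not_dense_degree r s a : s \notin dense_orders r ->
  degree (s @: positions n (level r)) a <= degree_bound r.
Proof.
move=> sD; rewrite leqNgt; apply: contra sD => /ltnW/subset_of_card[X Xs XD].
apply/bigcupP; exists a => //; apply/bigcupP; exists X.
  rewrite inE XD eqxx andbT; apply: subset_trans Xs _.
  by apply/subsetP => e; rewrite !inE => /andP[].
by rewrite inE; apply: subset_trans Xs _; apply/subsetP => e; rewrite inE => /andP[].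
Qed.

Lemma not_sparse_expanding r s : s \notin sparse_orders r ->
  expanding (s @: positions n (level r)) (set_bound r).
Proof.
move=> sS A B /subset_of_card[A' A'A cA'] /subset_of_card[B' B'B cB'] dAB.
have dAB' : [disjoint A' & B'] by exact: disjointW dAB.
have : ~~ [disjoint s @: positions n (level r) & joining A' B'].
  apply: contra sS => dis; apply/bigcupP; exists (A', B'); rewrite inE //=.
  by rewrite cA' cB' eqxx.
rewrite -setI_eq0 => /set0Pn[e]; rewrite inE => /andP[eG].
rewrite inE => /exists_inP[a aA' /exists_inP[b bB' /andP[ae be]]].
by exists e, a, b; rewrite (subsetP A'A) ?(subsetP B'B).
Qed.

(** Expansion is required only on levels that fit among the [M] edges; the others never start. *)
Definition bad_orders : {set {perm edge n}} :=
  \bigcup_(r in [set: 'I_L.+1])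
    (dense_orders r :|: (if level r <= M then sparse_orders r else set0)).

(** Each of the [L.+1] levels contributes probability at most [2 / 4 ^ L], while both [L.+1] and [n]
    are at most [2 ^ L]. *)
Lemma card_bad_orders : #|bad_orders| * n <= 2 * #|{perm edge n}|.
Proof.
have bad : #|bad_orders| * 4 ^ L <= L.+1 * (2 * #|{perm edge n}|).
  apply: leq_trans (card_bigcup_mul (d := 2 * #|{perm edge n}|) _) _; last first.
    by rewrite cardsT card_ord.
  move=> r _; apply: leq_trans (leq_mul (leq_card_setU _ _) (leqnn _)) _.
  rewrite mulnDl mul2n -addnn leq_add ?card_dense_orders //.
  by case: ifP => [/card_sparse_orders//|_]; rewrite cards0.
have LL : L < 2 ^ L by exact: ltn_expl.
have L0 : 0 < 2 ^ L by rewrite expn_gt0.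
rewrite -(leq_pmul2r L0); apply: leq_trans (_ : #|bad_orders| * 4 ^ L <= _).
  by rewrite -mulnA leq_mul2l -[4]/(2 * 2) expnMn leq_mul2r nL !orbT.
by apply: leq_trans bad _; rewrite mulnC leq_mul2l LL orbT.
Qed.

End GoodOrders.

(** * Cost of a single insertion order *)

Lemma geometric_sum_le c (a : nat -> nat) R :
  (forall r, a r * 2 ^ r <= c) -> \sum_(r < R) a r <= 2 * c.
Proof.
move=> ac; have : (\sum_(r < R) a r) * 2 ^ R + 2 * c <= 2 * c * 2 ^ R.
  elim: R => [|R IH]; first by rewrite big_ord0 expn0 mul0n muln1.
  rewrite big_ord_recr /= expnS; have := ac R; move: IH.
  by move: (bigop _ _ _) (2 ^ R) (a R) => u w b; nia.
have R0 : 0 < 2 ^ R by rewrite expn_gt0.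
by move=> le; rewrite -(leq_pmul2r R0); apply: leq_trans le; rewrite leq_addr.
Qed.

Lemma expn2_le_sum R q (P : pred nat) : q <= R -> (forall r, r < q -> P r) ->
  2 ^ q <= 1 + \sum_(r < R | P r) 2 ^ r.
Proof.
move=> qR Pq; have -> : 2 ^ q = 1 + \sum_(r < q) 2 ^ r.
  by elim: (q) => [|i IH]; rewrite ?big_ord0 // big_ord_recr /= addnA -IH addnn -mul2n expnS.
rewrite leq_add2l (big_ord_widen R (fun r => 2 ^ r) qR) big_mkcond [leqRHS]big_mkcond.
by apply: leq_sum => r _; case: ifP => // /Pq ->.
Qed.

Lemma positions_sub n i j : i <= j -> positions n i \subset positions n j.
Proof.
move=> ij; apply/subsetP => e; rewrite !inE -(take_takel _ ij); exact: mem_take.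
Qed.

Lemma size_first_edges n m (s : {perm edge n}) :
  size (first_edges m s) = minn m #|{: edge n}|.
Proof. by rewrite size_take_min size_map -cardE. Qed.

Lemma worst_nprocessed n (p : policy n) es i : 0 < n ->
  nprocessed (run p es i) <= size es + n.+1 * n ^ 2.
Proof.
move=> n0.
(* No levels are used: [theta] is constantly [n.+1], and [t = d = n] is admissible because
   [n ^ 2 + n = n * n.+1]. *)
have := @run_nprocessed n p es 0 n.+1 (fun=> 0) (fun=> 1) _ _ _ i.
rewrite !big_ord0 addn0; apply=> // j _; exists n, n; split=> //.
  move=> a; apply: leq_trans (leq_trans (card_incident a) (leq_pred n)).
  by apply/subset_leq_card/subsetP => e; rewrite !inE => /andP[].
by rewrite big_ord0 addn0 muln1; nia.
Qed.

Lemma worst_nchanged n (p : policy n) es i : 0 < n ->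
  nchanged (run p es i) <= n ^ 2 + n.
Proof.
move=> n0.
apply: (@run_nchanged n p es 0 n.+1 (fun=> 0) (fun=> 1)) => // j _.
exists n, n; split=> //.
  move=> a; apply: leq_trans (leq_trans (card_incident a) (leq_pred n)).
  by apply/subset_leq_card/subsetP => e; rewrite !inE => /andP[].
by rewrite big_ord0 addn0 muln1; nia.
Qed.

Section GoodRun.
Variables n L tau : nat.
Hypothesis n_gt1 : 1 < n.
Hypothesis nL : n <= 2 ^ L.
Hypothesis L_gt0 : 0 < L.
Hypothesis Ltau : L <= tau ^ 2.

(** The constant is [1 + 33 * 101]: one for the insertions, and 33 times [1 + 100] for the
    potential, with [1 <= tau]. *)
Lemma good_nprocessed (p : policy n) m s i : s \notin bad_orders n L tau ->
  nprocessed (run p (first_edges m s) i) <= 3334 * tau * n ^ 2.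
Proof.
move=> good; set es := first_edges m s.
have t_gt0 := tau_gt0 L_gt0 Ltau.
have M2 := twoM n.
have Mn : #|{: edge n}| <= n ^ 2.
  have : n.-1 <= n by exact: leq_pred.
  by move: M2; move: #|_| n.-1 => M n1 *; nia.
have ML : #|{: edge n}| <= level n tau L.
  apply: leq_trans Mn _; apply: leq_trans (_ : 4 ^ L <= _).
    by rewrite -mulnn -[4]/(2 * 2) expnMn leq_mul.
  by rewrite leq_pmulr // muln_gt0 (ltnW n_gt1) expn_gt0 t_gt0.
have es_m : size es <= m by rewrite size_first_edges geq_minl.
have es_M : size es <= #|{: edge n}| by rewrite size_first_edges geq_minr.
have goodr r : r < L.+1 -> s \notin dense_orders n tau r /\
    (level n tau r <= #|{: edge n}| -> s \notin sparse_orders n tau r).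
  move=> rL; move: good; rewrite /bad_orders => good; split.
    by apply: contra good => sr; apply/bigcupP; exists (Ordinal rL); rewrite // inE sr.
  by move=> lM; apply: contra good => sr; apply/bigcupP; exists (Ordinal rL); rewrite // inE lM sr orbT.
have set0 r : 0 < set_bound n r by rewrite /set_bound addn1.
have cost j : j <= size es -> exists t d,
    [/\ 0 < t, forall a, degree [set e in take j es] a <= d &
     t ^ 2 + d <= t * (33 * tau * (1 + \sum_(r < L.+1 | level n tau r < j) 2 ^ r))].
  move=> jes.
  have jL : j <= level n tau L by rewrite (leq_trans jes) // (leq_trans es_M).
  have ex : exists r, j <= level n tau r by exists L.
  (* The first level [r] with [j <= level n tau r] bounds the degrees, and all lower levels already
     count in [theta]. With [t = tau * 2 ^ r], the sum [t ^ 2 + d] is [33 * t ^ 2]. *)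
  case: (ex_minnP ex) => r jr rmin.
  have rL : r < L.+1 by rewrite ltnS rmin.
  exists (tau * 2 ^ r), (degree_bound tau r); split.
  - by rewrite muln_gt0 t_gt0 expn_gt0.
  - move=> a; rewrite first_edges_set ?(leq_trans jes) //.
    apply: leq_trans (not_dense_degree a (goodr r rL).1).
    exact/degree_sub/imsetS/positions_sub.
  have lower q : q < r -> level n tau q < j.
    by move=> qr; rewrite ltnNge; apply/negP => /rmin; rewrite leqNgt qr.
  have := expn2_le_sum (P := fun q => level n tau q < j) (ltnW rL) lower.
  have -> : degree_bound tau r = 32 * (tau * 2 ^ r) ^ 2.
    by rewrite /degree_bound expnMn -[4]/(2 ^ 2) -!expnM [2 * r]mulnC [_ * tau ^ 2]mulnC.
  move: (bigop _ _ _) (2 ^ r) => u w wu.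
  apply: leq_trans (_ : tau * w * (33 * tau * w) <= _); last by rewrite !leq_mul.
  by rewrite -mulnn; lia.
have expd r : r < L.+1 -> level n tau r < size es ->
    expanding [set e in take (level n tau r) es] (set_bound n r).
  move=> rL lr; rewrite first_edges_set; last by rewrite ltnW // (leq_trans lr).
  by apply: not_sparse_expanding; apply: (goodr r rL).2; rewrite ltnW // (leq_trans lr).
apply: leq_trans (@run_nprocessed n p es L.+1 (33 * tau) _ _ cost set0 expd i) _.
have sum : \sum_(r < L.+1 | level n tau r < size es) 2 ^ r * (10 * set_bound n r * n) <= 100 * n ^ 2.
  pose a r := if level n tau r < size es then 2 ^ r * set_bound n r else 0.
  (* A level that starts satisfies [4 ^ r <= n], as [level n tau r] is below [n ^ 2]; this absorbs
     the unit added in [set_bound]. *)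
  have ar r : a r * 2 ^ r <= 5 * n.
    rewrite /a; case: ifP => // lr.
    have rn : 4 ^ r <= n.
      rewrite -(leq_pmul2l (ltnW n_gt1)) mulnn.
      apply: leq_trans (leq_trans (ltnW lr) (leq_trans es_M Mn)).
      by rewrite /level mulnC leq_mul2l leq_pmulr ?orbT // expn_gt0 t_gt0.
    have : 4 ^ r * ((4 * n) %/ 4 ^ r) <= 4 * n by rewrite mulnC leq_trunc_div.
    have -> : 2 ^ r * set_bound n r * 2 ^ r = 4 ^ r * set_bound n r.
      by rewrite mulnAC -expnMn.
    by rewrite /set_bound mulnDr muln1; lia.
  have a_sum := geometric_sum_le L.+1 ar.
  rewrite big_mkcond (eq_bigr (fun r : 'I_L.+1 => 10 * n * a r)) => [|r _].
    rewrite -big_distrr /=; apply: leq_trans (leq_mul (leqnn _) a_sum) _.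
    by rewrite -mulnn; lia.
  by rewrite /a; case: ifP => _; rewrite ?muln0 //; lia.
have esn : size es <= n ^ 2 by exact: leq_trans Mn.
move: sum esn; move: (bigop _ _ _) (n ^ 2) => u w *; nia.
Qed.

(** Depends on neither the policy nor the prefix length, so averaging over orders no longer involves
    runs. *)
Definition order_cost (s : {perm edge n}) : nat :=
  if s \in bad_orders n L tau then 3 * n ^ 3 else 3334 * tau * n ^ 2.

Lemma nprocessed_le (p : policy n) m s i :
  nprocessed (run p (first_edges m s) i) <= order_cost s.
Proof.
rewrite /order_cost; case: ifP => [_|/negbT]; last exact: good_nprocessed.
apply: leq_trans (worst_nprocessed p _ i (ltnW n_gt1)) _.
have : size (first_edges m s) <= #|{: edge n}| by rewrite size_first_edges geq_minr.
have := twoM n; have : n.-1 <= n by exact: leq_pred.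
by move: #|_| n.-1 (size _) => M n1 e *; nia.
Qed.

(** Bad orders have frequency at most [2 / n], so they add at most [6 * n ^ 2] to the average, and
    [3340 = 3334 + 6]. *)
Lemma sum_order_cost :
  \sum_(s : {perm edge n}) order_cost s <= #|{perm edge n}| * (3340 * tau * n ^ 2).
Proof.
apply: leq_trans (_ : #|bad_orders n L tau| * (3 * n ^ 3) +
  #|{perm edge n}| * (3334 * tau * n ^ 2) <= _).
  rewrite -!sum_nat_const (big_mkcond (mem (bad_orders n L tau))) -big_split /=.
  by apply: leq_sum => s _; rewrite /order_cost; case: ifP => _; rewrite ?leq_addr ?leq_addl.
have t_gt0 := tau_gt0 L_gt0 Ltau.
rewrite (_ : 3 * n ^ 3 = n * (3 * n ^ 2)); last by rewrite mulnCA -expnS.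
rewrite mulnA; apply: leq_trans (leq_add (leq_mul (card_bad_orders _ _ _ _) (leqnn _)) (leqnn _)) _ => //.
rewrite -mulnA mulnCA -mulnDr leq_mul2l; apply/orP; right.
by move: (n ^ 2) => w; nia.
Qed.

End GoodRun.

(** * Expected time *)

From mathcomp Require Import boolp classical_sets reals ereal exp.

Import Order.TTheory GRing.Theory Num.Theory.
Local Open Scope ring_scope.

(** Take the least [tau] with [L <= tau ^ 2]: from 2 on it is at most twice its predecessor, whose
    square is below [L]. *)
Lemma small_square (L : nat) : (0 < L)%N ->
  exists2 tau : nat, (L <= tau ^ 2)%N & (tau ^ 2 <= 4 * L)%N.
Proof.
move=> L0; have ex : exists tau, (L <= tau ^ 2)%N by exists L; rewrite -mulnn leq_pmulr.
case: (ex_minnP ex) => tau Lt tmin; exists tau => //.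
case: tau Lt tmin => [|[|t]] // Lt tmin; first by rewrite (leq_trans L0) // leq_pmull.
have lt : (t.+1 ^ 2 < L)%N by rewrite ltnNge; apply/negP => /tmin; rewrite ltnn.
apply: (@leq_trans (4 * t.+1 ^ 2)%N); last by rewrite leq_mul2l ltnW // orbT.
by rewrite -[4%N]/(2 ^ 2)%N -expnMn leq_sqr mul2n -addnn addSn ltnS addnS ltnS leq_addr.
Qed.

Section Bounds.
Variables (R : realType) (n : nat) (p : policy n).
Hypothesis n_gt1 : (1 < n)%N.

Lemma edges_processed_le L tau m (s : {perm edge n}) :
  (n <= 2 ^ L)%N -> (0 < L)%N -> (L <= tau ^ 2)%N ->
  (edges_processed p R (first_edges m s) <= ((order_cost L tau s)%:R : R)%:E)%E.
Proof.
move=> nL L0 Lt; apply: ge_ereal_sup => _ [i _ <-].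
by rewrite lee_fin ler_nat; exact: nprocessed_le.
Qed.

Lemma vertices_changed_le es :
  (0 <= vertices_changed p R es <= ((2 * n ^ 2)%:R : R)%:E)%E.
Proof.
apply/andP; split.
  apply: (@le_trans _ _ ((nchanged (run p es 0))%:R : R)%:E); first by rewrite lee_fin.
  by apply: ereal_sup_ubound; exists 0%N.
apply: ge_ereal_sup => _ [i _ <-]; rewrite lee_fin ler_nat.
apply: leq_trans (worst_nchanged p es i (ltnW n_gt1)) _.
by rewrite mul2n -addnn leq_add2l -mulnn leq_pmulr // ltnW.
Qed.

Lemma update_time_le (c : R) (d : R) es :
  (d%:E <= c%:E * vertices_changed p R es)%E -> d <= `|c| * (2 * n ^ 2)%:R.
Proof.
have /andP[V0 V1] := vertices_changed_le es.
move=> dV; rewrite -lee_fin EFinM; apply: le_trans dV _.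
apply: le_trans (_ : `|c|%:E * vertices_changed p R es <= _)%E.
  by apply: lee_wpmul2r => //; rewrite lee_fin ler_norm.
by apply: lee_wpmul2l => //; rewrite lee_fin.
Qed.

(** With [L] the rounded-up binary logarithm, both [L.-1 * ln 2] and [ln 2] are at most [ln n], so
    [tau ^ 2 <= 4 * L <= 8 * ln n / ln 2]. *)
Lemma log_scale : exists L tau : nat,
  [/\ (n <= 2 ^ L)%N, (0 < L)%N, (L <= tau ^ 2)%N, (0 < tau)%N &
   tau%:R <= Num.sqrt (8 / ln 2) * Num.sqrt (ln n%:R) :> R].
Proof.
have /andP[lo hi] := up_log_bounds (isT : (1 < 2)%N) n_gt1.
set L := up_log 2 n in lo hi.
have L0 : (0 < L)%N by rewrite lt0n; apply: contraTneq hi => ->; rewrite -ltnNge.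
have [tau Lt tL] := small_square L0; exists L, tau.
have t0 : (0 < tau)%N by case: (tau) Lt => //; rewrite leqNgt L0.
split=> //.
have ln2 : 0 < ln 2 :> R by rewrite ln_gt0 // ltr1n.
have ln2n : ln 2 <= ln n%:R :> R by rewrite ler_ln ?posrE ?ltr0n ?ler_nat // ltnW.
have Lln : L.-1%:R * ln 2 <= ln n%:R :> R.
  rewrite mulr_natl -lnXn // -natrX ler_ln ?posrE ?ltr0n ?expn_gt0 //; last exact: ltnW.
  by rewrite ler_nat ltnW.
rewrite -sqrtrM ?divr_ge0 ?(ltW ln2) // -[tau%:R]ger0_norm // -sqrtr_sqr.
apply: ler_wsqrtr; rewrite mulrAC ler_pdivlMr // -natrX.
apply: (@le_trans _ _ ((4 * L)%:R * ln 2)).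
  by rewrite ler_pM2r // ler_nat.
have LE : L%:R * ln 2 = L.-1%:R * ln 2 + ln 2 :> R.
  by rewrite -[in LHS](prednK L0) -natr1 mulrDl mul1r.
by rewrite natrM -mulrA LE; lra.
Qed.

End Bounds.

(** Here [ds es] is the time for updating the LCA and level-ancestor structure, amortized to [c] per
    changed vertex. The number of changes is bounded for every order, so only the processed edges
    need averaging. *)
Theorem theorem6p1 (R : realType) (c : R) :
  exists C : R, forall (n : nat) (p : policy n) (ds : seq (edge n) -> R) (m : nat),
    (1 < n)%N -> (m <= 'C(n, 2))%N ->
    (forall es, ((ds es)%:E <= c%:E * vertices_changed p R es)%E) ->
    (uniform_mean (fun s : {perm edge n} =>
        edges_processed p R (first_edges m s) + (ds (first_edges m s))%:E)
     <= (C * n%:R ^+ 2 * Num.sqrt (ln n%:R))%:E)%E.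
Proof.
(* The summand 3340 comes from processed edges, the other from at most [2 * n ^ 2] vertex changes,
   and the square root from the bound on [tau]. *)
exists ((3340 + 2 * `|c|) * Num.sqrt (8 / ln 2)) => n p ds m n1 _ dsV.
have [L [tau [nL L0 Lt t0 tE]]] := log_scale R n1.
pose W := {perm edge n}.
have cW : 0 < #|W|%:R :> R by rewrite ltr0n; apply/card_gt0P; exists 1%g.
pose b (s : W) : R := (order_cost L tau s)%:R + `|c| * (2 * n ^ 2)%:R.
apply: (@le_trans _ _ ((#|W|%:R^-1)%:E * (\sum_(s : W) b s)%:E)%E).
  apply: lee_wpmul2l; first by rewrite lee_fin invr_ge0 ltW.
  rewrite -sumEFin; apply: lee_sum => s _; rewrite EFinD; apply: leeD.
    exact: edges_processed_le.
  by rewrite lee_fin; exact: update_time_le (dsV _).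
rewrite -EFinM lee_fin ler_pdivrMl // big_split /= -natr_sum.
have -> x : \sum_(s : W) x = #|W|%:R * x :> R by rewrite sumr_const mulr_natl.
have := sum_order_cost n1 nL L0 Lt; rewrite -(ler_nat R) => cost.
apply: le_trans (lerD cost (lexx _)) _.
rewrite natrM -mulrDr ler_pM2l //.
rewrite [(2 * _)%:R]natrM [(3340 * tau * _)%:R]natrM [(3340 * tau)%:R]natrM natrX.
(* The update term lacks the factor [tau], which [1 <= tau] supplies. *)
have tR : 1 <= tau%:R :> R by rewrite ler1n.
apply: (@le_trans _ _ ((3340 + 2 * `|c|) * n%:R ^+ 2 * tau%:R)).
  rewrite -subr_ge0 (_ : _ - _ = 2 * `|c| * n%:R ^+ 2 * (tau%:R - 1)); last by ring.
  by rewrite !mulr_ge0 ?subr_ge0 // exprn_ge0.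
rewrite [_ * Num.sqrt (8 / _)]mulrC [leRHS](_ : _ = (3340 + 2 * `|c|) * n%:R ^+ 2 *
  (Num.sqrt (8 / ln 2) * Num.sqrt (ln n%:R))); last by ring.
apply: ler_wpM2l tE; apply: mulr_ge0; last exact: exprn_ge0.
by apply: addr_ge0; [exact: ler0n | exact: mulr_ge0].
Qed.
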